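(* Let $X\subseteq\{0,1\}^n$, $f:X\to\{0,1\}$, and suppose there is an $f$-deciding vector set with maximum rank $\kappa$ and size $A$. Then (by Johnson–Lindenstrauss compression of this vector set) there is a quantum query algorithm that, for every input $x\in X$, outputs $f(x)$ with probability at least $2/3$, has query complexity $O(A)$, and uses $O(\log(\kappa n))$ qubits.
   Context: An $f$-deciding vector set is a family $\{\ket{v_{x,j}}\in\mathbb{C}^m\}_{x\in X,j\in[n]}$ such that for all $x,y\in X$ with $f(x)\ne f(y)$, $\sum_{j:x_j\ne y_j}\braket{v_{x,j}}{v_{y,j}}=1$. Its size is $\max_{x\in X}\sum_j\|\ket{v_{x,j}}\|^2$ and its maximum rank is $\max_{j\in[n]}\dim\operatorname{span}\{\ket{v_{x,j}}:f(x)=1\}$. A quantum query algorithm has the form $U_TO_xU_{T-1}O_x\cdots U_1O_xU_0\ket{\hat 0}$ followed by a two-outcome measurement, with $x$-independent unitaries $U_t$ on a Hilbert space of dimension $S$ and oracle $O_x\ket{i}\ket{b}=\ket{i}\ket{b\oplus x_i}$; its query complexity is $T$ and it uses $\log S$ qubits. *)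

(* Defs.v *)
From HB Require Import structures.
From mathcomp Require Import all_boot all_order all_algebra.
From mathcomp Require Import complex.
From mathcomp Require Import reals.

Set Implicit Arguments.
Unset Strict Implicit.
Unset Printing Implicit Defensive.

Import Order.TTheory GRing.Theory Num.Theory.
Local Open Scope ring_scope.

Definition bits (n : nat) := {ffun 'I_n -> bool}.

Section Defs.
Variable R : realType.
Local Notation C := R[i].

Definition cconj (z : C) : C := conjc z.
Definition adj (p q : nat) (A : 'M[C]_(p, q)) : 'M[C]_(q, p) := (map_mx cconj A)^T.

Definition braket (m : nat) (u v : 'cV[C]_m) : C :=
  \sum_(k < m) cconj (u k 0) * v k 0.

Definition sqnorm (m : nat) (u : 'cV[C]_m) : R :=
  \sum_(k < m) (complex.Re (u k 0) ^+ 2 + complex.Im (u k 0) ^+ 2).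

Definition deciding (n m : nat) (X : {set bits n}) (f : bits n -> bool)
  (v : bits n -> 'I_n -> 'cV[C]_m) : Prop :=
  forall x y, x \in X -> y \in X -> f x != f y ->
    \sum_(j < n | x j != y j) braket (v x j) (v y j) = 1.

Definition vsize (n m : nat) (X : {set bits n}) (v : bits n -> 'I_n -> 'cV[C]_m) : R :=
  \big[Num.max/0]_(x in X) \sum_(j < n) sqnorm (v x j).

Definition maxrank (n m : nat) (X : {set bits n}) (f : bits n -> bool)
  (v : bits n -> 'I_n -> 'cV[C]_m) : nat :=
  \max_(j < n) \rank (\sum_(x in X | f x) <<(v x j)^T>>)%MS.

(* The Hilbert space has orthonormal basis |i>|b>|w> with i in [n] (query index),
   b a bit (query answer), w in [W] (workspace); its dimension is
   S = #|'I_n * bool * 'I_W| = 2 n W, and the algorithm uses log S qubits. *)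
Definition qdim (n W : nat) : nat := #|{: 'I_n * bool * 'I_W}|.

Definition flipq (n W : nat) (x : bits n) (q : 'I_n * bool * 'I_W) : 'I_n * bool * 'I_W :=
  let: (i, b, w) := q in (i, addb b (x i), w).

Definition oracle (n W : nat) (x : bits n) : 'M[C]_(qdim n W) :=
  \matrix_(a, c) (enum_val a == flipq x (enum_val c))%:R.

Definition unitary (S : nat) (U : 'M[C]_S) : Prop := U *m adj U = 1%:M.
Definition projector (S : nat) (P : 'M[C]_S) : Prop := P *m P = P /\ adj P = P.

Fixpoint run (S : nat) (O : 'M[C]_S) (U : nat -> 'M[C]_S) (psi0 : 'cV[C]_S)
  (t : nat) : 'cV[C]_S :=
  match t with
  | 0 => U 0%N *m psi0
  | t'.+1 => U t *m (O *m run O U psi0 t')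
  end.

(* A T-query algorithm on S = qdim n W dimensions: x-independent unitaries U_0..U_T,
   initial basis state |0hat> = |i0>, two-outcome projective measurement {P, 1 - P};
   outcome "1" corresponds to P. It computes f on X with probability >= 2/3. *)
Definition computes (n W T : nat) (U : nat -> 'M[C]_(qdim n W)) (i0 : 'I_(qdim n W))
  (P : 'M[C]_(qdim n W)) (X : {set bits n}) (f : bits n -> bool) : Prop :=
  (forall t, (t <= T)%N -> unitary (U t)) /\ projector P /\
  forall x, x \in X ->
    let psi := run (oracle W x) U (delta_mx i0 0) T in
    if f x then sqnorm (P *m psi) >= 2 / 3
    else sqnorm ((1%:M - P) *m psi) >= 2 / 3.

End Defs.

(* Main.v *)
Require Import Defs.
From HB Require Import structures.
From mathcomp Require Import all_boot all_order all_algebra.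
From mathcomp Require Import complex.
From mathcomp Require Import reals.
From mathcomp Require Import spectral ring lra zify.
Import Order.TTheory GRing.Theory Num.Theory.
Local Open Scope ring_scope.

Set Implicit Arguments.
Unset Strict Implicit.
Unset Printing Implicit Defensive.

(* Projecting every v_{x,j} onto span {v_{x,j} : f x = 1} keeps the inner
   products between inputs of different value and does not increase norms, so
   we may take m = kappa; no random projection is needed.

   Add to C^n (x) C^2 (x) C^kappa two basis states |s>, |o> untouched by queries,
   and put
     psi_x = |o> + alpha   sum_j |j, x_j>  v_{x,j}   (f x = 1),
     t_y   = |o> - alpha^-1 sum_j |j, ~y_j> v_{y,j}   (f y = 0).
   The deciding condition says <t_y, psi_x> = 0.  Let L reflect through
   span {t_y}^perp, let Q_x be the two-query reflection with sign +1 on |j, x_j>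
   and -1 on |j, ~x_j>, and let R be a rotation by a small angle phi in the plane
   (s, o).  The walk V_x = Q_x L R starts at |s>.
   If f x = 1, psi_x is fixed by Q_x L and is close to |o> for small alpha, so
   after N = pi / (2 phi) steps the walk has moved to psi_x, orthogonal to |s>.
   If f y = 0, then Q_y L t_y = t_y - 2 |o>, and
   |s> + tan (phi / 2) (t_y - 2 |o>) is exactly fixed by V_y, so the walk never
   leaves the vicinity of |s> as soon as phi |t_y| is small.  As |t_y| = O(A) for
   alpha^2 = Theta (1 / A), N = O(A) steps suffice, and no phase-estimation
   register is used. *)

(** * Adjoints, norms, unitaries and orthogonal projectors over [R[i]] *)

Section LinearAlgebra.
Variable R : realType.
Local Notation C := R[i].

Lemma map_cconjK p q (A : 'M[C]_(p, q)) : map_mx (@cconj R) (map_mx (@cconj R) A) = A.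
Proof. by apply/matrixP=> i j; rewrite !mxE /cconj conjcK. Qed.

Lemma map_cconjM p q r (A : 'M[C]_(p, q)) (B : 'M[C]_(q, r)) :
  map_mx (@cconj R) (A *m B) = map_mx (@cconj R) A *m map_mx (@cconj R) B.
Proof. exact: (map_mxM (@conjc R)). Qed.

Lemma adjM p q r (A : 'M[C]_(p, q)) (B : 'M[C]_(q, r)) :
  adj (A *m B) = adj B *m adj A.
Proof. by rewrite /adj map_cconjM trmx_mul. Qed.

Lemma adjK p q (A : 'M[C]_(p, q)) : adj (adj A) = A.
Proof. by rewrite /adj -map_trmx trmxK map_cconjK. Qed.

Lemma adj1 p : adj (1%:M : 'M[C]_p) = 1%:M.
Proof. by rewrite /adj (map_mx1 (@conjc R)) trmx1. Qed.

Lemma adjB p q (A B : 'M[C]_(p, q)) : adj (A - B) = adj A - adj B.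
Proof. by rewrite /adj (map_mxB (@conjc R)) linearB. Qed.

Lemma adjD p q (A B : 'M[C]_(p, q)) : adj (A + B) = adj A + adj B.
Proof. by rewrite /adj (map_mxD (@conjc R)) linearD. Qed.

Lemma adjZ p q (z : C) (A : 'M[C]_(p, q)) : adj (z *: A) = cconj z *: adj A.
Proof. by rewrite /adj (map_mxZ (@conjc R)) linearZ. Qed.

Lemma braketE p (u v : 'cV[C]_p) : braket u v = (adj u *m v) 0 0.
Proof. by rewrite mxE; apply: eq_bigr => k _; rewrite !mxE. Qed.

Lemma adj_mulE p (u v : 'cV[C]_p) : adj u *m v = (braket u v)%:M.
Proof. by apply/matrixP=> i j; rewrite !ord1 braketE [RHS]mxE mulr1n. Qed.

Lemma braket_conj p (u v : 'cV[C]_p) : cconj (braket u v) = braket v u.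
Proof.
rewrite /braket /cconj rmorph_sum; apply: eq_bigr => k _.
by rewrite rmorphM /= conjcK mulrC.
Qed.

Lemma braket_sqnorm p (u : 'cV[C]_p) : braket u u = (sqnorm u)%:C%C.
Proof.
rewrite /braket /sqnorm rmorph_sum; apply: eq_bigr => k _.
by case: (u k 0) => a b /=; simpc; congr (Complex _ _); ring.
Qed.

Lemma sqnormN p (u : 'cV[C]_p) : sqnorm (- u) = sqnorm u.
Proof.
apply: eq_bigr => k _; rewrite !mxE; case: (u k 0) => a b /=.
by rewrite !sqrrN.
Qed.

Lemma sqnormZ p (z : R) (u : 'cV[C]_p) : sqnorm (z%:C%C *: u) = z ^+ 2 * sqnorm u.
Proof.
rewrite /sqnorm mulr_sumr; apply: eq_bigr => k _; rewrite !mxE.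
by case: (u k 0) => a b /=; ring.
Qed.

Lemma sqnorm_ge0 p (u : 'cV[C]_p) : 0 <= sqnorm u.
Proof. by apply: sumr_ge0 => k _; rewrite addr_ge0 ?sqr_ge0. Qed.

Lemma sqnorm_coord p (u : 'cV[C]_p) k :
  complex.Re (u k 0) ^+ 2 + complex.Im (u k 0) ^+ 2 <= sqnorm u.
Proof.
rewrite /sqnorm (bigD1 k) //= lerDl.
by apply: sumr_ge0 => i _; rewrite addr_ge0 ?sqr_ge0.
Qed.

(** Coordinatewise, the right side exceeds the left by [d^-1 * (d * a - b) ^+ 2]. The free weight
    [d] lets errors accumulate without square roots of norms. *)
Lemma sqnormD_le p (u v : 'cV[C]_p) (d : R) : 0 < d ->
  sqnorm (u + v) <= (1 + d) * sqnorm u + (1 + d^-1) * sqnorm v.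
Proof.
move=> d0.
have aux (a b : R) : (a + b) ^+ 2 <= (1 + d) * a ^+ 2 + (1 + d^-1) * b ^+ 2.
  have -> : (1 + d) * a ^+ 2 + (1 + d^-1) * b ^+ 2 =
            (a + b) ^+ 2 + d^-1 * (d * a - b) ^+ 2 by field; rewrite gt_eqF.
  by rewrite lerDl mulr_ge0 ?sqr_ge0 // invr_ge0 ltW.
rewrite /sqnorm !mulr_sumr -big_split; apply: ler_sum => k _; rewrite !mxE.
case: (u k 0) => a b; case: (v k 0) => a' b' /=.
have := aux a a'; have := aux b b'; lra.
Qed.

Lemma sqnorm_isometry p q (G : 'M[C]_(q, p)) (u : 'cV[C]_p) :
  adj G *m (G *m u) = u -> sqnorm (G *m u) = sqnorm u.
Proof.
move=> GGu; apply: (@complexI R); rewrite -!braket_sqnorm !braketE.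
by rewrite adjM -mulmxA GGu.
Qed.

Lemma unitary_adjl p (U : 'M[C]_p) : unitary U -> adj U *m U = 1%:M.
Proof. by move/mulmx1C. Qed.

Lemma sqnorm_unitary p (U : 'M[C]_p) (u : 'cV[C]_p) :
  unitary U -> sqnorm (U *m u) = sqnorm u.
Proof.
by move=> UU; apply: sqnorm_isometry; rewrite mulmxA unitary_adjl ?mul1mx.
Qed.

Lemma unitaryM p (U V : 'M[C]_p) : unitary U -> unitary V -> unitary (U *m V).
Proof.
by rewrite /unitary adjM => UU VV; rewrite mulmxA -(mulmxA U) VV mulmx1.
Qed.

Lemma unitary1 p : unitary (1%:M : 'M[C]_p).
Proof. by rewrite /unitary adj1 mulmx1. Qed.

Lemma unitary_reflection p (P : 'M[C]_p) : projector P -> unitary (1%:M - (P + P)).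
Proof.
case=> PP aP; rewrite /unitary adjB adj1 adjD aP mulmxBl mul1mx mulmxBr mulmx1 mulmxDl !mulmxDr PP.
by apply/matrixP=> i j; rewrite !mxE; ring.
Qed.

(** Gram-Schmidt on a row basis of [F]. Vectors enter row spaces as plain transposes while [braket]
    conjugates its first argument, hence [G] is the entrywise conjugate of the Schmidt matrix;
    [adj G *m G] is then the orthogonal projector onto the span. *)
Lemma ortho_basis p q (F : 'M[C]_(p, q)) :
  exists G : 'M[C]_(\rank F, q),
  [/\ G *m adj G = 1%:M,
      forall u : 'cV[C]_q, (u^T <= F)%MS -> adj G *m (G *m u) = u
    & forall u : 'cV[C]_q, F *m map_mx (@cconj R) u = 0 -> G *m u = 0].
Proof.
pose E := schmidt (row_base F).
have EF : (E :=: F)%MS.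
  by apply: eqmx_trans (eq_row_base F); apply: eqmx_schmidt_free; exact: row_base_free.
have EE : E *m adj E = 1%:M.
  have /unitarymxP := schmidt_unitarymx (row_base F) (rank_leq_col F).
  by rewrite /adj map_trmx.
have cEE : map_mx (@cconj R) E *m E^T = 1%:M.
  have := congr1 (map_mx (@cconj R)) EE.
  by rewrite map_cconjM /adj map_trmx map_cconjK (map_mx1 (@conjc R)).
have aE : adj (map_mx (@cconj R) E) = E^T by rewrite /adj map_cconjK.
exists (map_mx (@cconj R) E); rewrite aE; split=> // u.
- move=> uF; have /submxP [d ud] : (u^T <= E)%MS by rewrite EF.
  rewrite -[u]trmxK ud trmx_mul.
  by rewrite (mulmxA (map_mx _ _)) cEE mul1mx.
- move=> Fu; have /submxP [d Ed] : (E <= F)%MS by rewrite EF.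
  apply: (can_inj (@map_cconjK _ _)).
  by rewrite map_cconjM map_cconjK Ed -mulmxA Fu mulmx0 (map_mx0 (@conjc R)).
Qed.

Definition span_of (I : finType) (A : {pred I}) q (t : I -> 'cV[C]_q) : 'M[C]_q :=
  (\sum_(i in A) <<(t i)^T>>)%MS.

Lemma sub_span_of (I : finType) (A : {pred I}) q (t : I -> 'cV[C]_q) i :
  i \in A -> ((t i)^T <= span_of A t)%MS.
Proof. by move=> Ai; apply: (sumsmx_sup i); rewrite ?genmxE. Qed.

Lemma span_of_ortho (I : finType) (A : {pred I}) q (t : I -> 'cV[C]_q) u :
  (forall i, i \in A -> braket (t i) u = 0) -> span_of A t *m map_mx (@cconj R) u = 0.
Proof.
move=> tu; apply/eqP; rewrite -sub_kermx; apply/sumsmx_subP => i Ai.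
rewrite genmxE sub_kermx; apply/eqP/matrixP=> a b; rewrite !ord1 [RHS]mxE.
have := congr1 (@cconj R) (tu i Ai); rewrite braketE => h.
have -> : 0 = cconj (0 : C) by rewrite /cconj conjc0.
rewrite -h !mxE /cconj rmorph_sum; apply: eq_bigr => k _.
by rewrite !mxE /cconj rmorphM /= conjcK.
Qed.

Lemma ortho_projector (I : finType) (A : {pred I}) q (t : I -> 'cV[C]_q) :
  exists P : 'M[C]_q,
  [/\ projector P, forall i, i \in A -> P *m t i = t i
    & forall u, (forall i, i \in A -> braket (t i) u = 0) -> P *m u = 0].
Proof.
have [G [GG Gt G0]] := ortho_basis (span_of A t).
exists (adj G *m G); split.
- split; last by rewrite adjM adjK.
  by rewrite mulmxA -(mulmxA (adj G)) GG mulmx1.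
- by move=> i Ai; rewrite -mulmxA Gt ?sub_span_of.
- by move=> u /span_of_ortho /G0 Gu; rewrite -mulmxA Gu mulmx0.
Qed.

Lemma line_projector q (p : 'cV[C]_q) (z : R) : z != 0 -> sqnorm p = z ->
  projector (z^-1%:C%C *: (p *m adj p)).
Proof.
move=> z0 pz; split; last first.
  by rewrite adjZ adjM adjK /cconj conjc_real.
rewrite -scalemxAl -scalemxAr mulmxA -(mulmxA p) adj_mulE braket_sqnorm pz.
rewrite mul_mx_scalar -scalemxAl scalerA -(rmorphM (real_complex R)) /= mulVf //.
by rewrite scale1r.
Qed.
End LinearAlgebra.

(** * Plane rotations by small angles, and the walk they drive *)

Section Rotation.
Variable R : realType.
Local Notation C := R[i].
Local Open Scope complex_scope.

Lemma real_complex_pushE : (((forall x y : R, (x - y)%:C = x%:C - y%:C) *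
  (forall x y : R, (x + y)%:C = x%:C + y%:C)) *
  ((forall x y : R, (x * y)%:C = x%:C * y%:C) *
  (forall (x : R) k, (x ^+ k)%:C = x%:C ^+ k))) *
  (((1 : R)%:C = 1) * (forall k, (k%:R : R)%:C = k%:R)).
Proof.
do !split; try exact: (rmorphB (real_complex R)); try exact: (rmorphD (real_complex R)).
- exact: (rmorphM (real_complex R)).
- by move=> x k; rewrite (rmorphXn (real_complex R)).
- exact: (rmorph_nat (real_complex R)).
Qed.

Lemma sqnorm_le0 p (u : 'cV[C]_p) : sqnorm u <= 0 -> u = 0.
Proof.
move=> u0; apply/matrixP=> i j; rewrite ord1 mxE.
have := le_trans (sqnorm_coord u i) u0; case: (u i 0) => a b /= ab.
have /eqP : a ^+ 2 + b ^+ 2 = 0 by apply/eqP; rewrite eq_le ab addr_ge0 ?sqr_ge0.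
by rewrite paddr_eq0 ?sqr_ge0 // !sqrf_eq0 => /andP [/eqP -> /eqP ->].
Qed.

(* cos phi and sin phi for tau = tan (phi / 2). *)
Definition rotc (tau : R) : R := (1 - tau ^+ 2) / (1 + tau ^+ 2).
Definition rots (tau : R) : R := 2 * tau / (1 + tau ^+ 2).

Lemma sqr1p_neq0 (tau : R) : 1 + tau ^+ 2 != 0.
Proof. by rewrite gt_eqF // ltr_pwDl ?ltr01 ?sqr_ge0. Qed.

Lemma rotcs (tau : R) : rotc tau + tau * rots tau = 1.
Proof. by rewrite /rotc /rots; field; exact: sqr1p_neq0. Qed.

Lemma rotsc (tau : R) : rots tau - tau * rotc tau = tau.
Proof. by rewrite /rotc /rots; field; exact: sqr1p_neq0. Qed.

(** This is tan (x / 2) = tan x / (1 + sec x): [r] is the secant, and [1 <= r] gives the halving. *)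
Lemma half_angle (tau : R) : 0 <= tau -> exists2 tau', 0 <= tau' <= tau / 2 &
  (rotc tau' +i* rots tau') ^+ 2 = rotc tau +i* rots tau.
Proof.
move=> t0; pose r := Num.sqrt (1 + tau ^+ 2).
have r2 : r ^+ 2 = 1 + tau ^+ 2 by rewrite sqr_sqrtr // addr_ge0 ?ler01 ?sqr_ge0.
have r1 : 1 <= r by rewrite -[1]sqrtr1 ler_wsqrtr // lerDl sqr_ge0.
have r10 : 0 < 1 + r by apply: ltr_pwDl => //; lra.
pose t := tau / (1 + r).
have t'0 : 0 <= t by rewrite divr_ge0 // ltW.
have tt : tau * (1 - t ^+ 2) = 2 * t.
  have r10' : 1 + r != 0 by rewrite gt_eqF.
  apply: (mulIf (expf_neq0 2 r10')).
  have -> : tau * (1 - t ^+ 2) * (1 + r) ^+ 2 = tau * ((1 + r) ^+ 2 - tau ^+ 2).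
    by rewrite /t; field.
  have -> : 2 * t * (1 + r) ^+ 2 = 2 * tau * (1 + r) by rewrite /t; field.
  have -> : tau ^+ 2 = r ^+ 2 - 1 by rewrite r2; ring.
  by ring.
exists t; first rewrite t'0 /=.
  by apply: ler_wpM2l => //; rewrite lef_pV2 ?posrE //; lra.
have t1 : t ^+ 2 < 1.
  have h : t * (1 + r) = tau by rewrite /t; field; rewrite gt_eqF.
  nra.
have ht : tau = 2 * t / (1 - t ^+ 2).
  by rewrite -tt; field; rewrite subr_eq0 gt_eqF.
have nz : 1 - t ^+ 2 != 0 by rewrite subr_eq0 gt_eqF.
have nz' := sqr1p_neq0 t.
have nz'' : (1 - t ^+ 2) ^+ 2 + (2 * t) ^+ 2 != 0.
  have -> : (1 - t ^+ 2) ^+ 2 + (2 * t) ^+ 2 = (1 + t ^+ 2) ^+ 2 by ring.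
  exact: expf_neq0.
rewrite expr2 ht /rotc /rots; simpc; congr (Complex _ _); field; by rewrite nz nz' nz''.
Qed.

(** Start from the quarter turn, [tau = 1], and halve the angle [K] times. *)
Lemma root_of_i K : exists2 tau : R, 0 <= tau <= (2 ^+ K)^-1 &
  (rotc tau +i* rots tau) ^+ (2 ^ K) = 'i.
Proof.
elim: K => [|K [tau /andP [t0 tK] IH]].
  exists 1; first by rewrite expr0 invr1 ler01 lexx.
  by rewrite expr1 /rotc /rots expr1n subrr mul0r mulr1 divff // (pnatr_eq0 _ 2).
have [t /andP[t'0 t't] tt] := half_angle t0.
exists t; last by rewrite expnS exprM tt IH.
rewrite t'0 exprS invfM mulrC (le_trans t't) //.
by rewrite ler_pM2r // invr_gt0 ltr0n.
Qed.

Lemma braketDl p (u v w : 'cV[C]_p) : braket (u + v) w = braket u w + braket v w.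
Proof. by rewrite !braketE adjD mulmxDl mxE. Qed.

Lemma braketDr p (u v w : 'cV[C]_p) : braket w (u + v) = braket w u + braket w v.
Proof. by rewrite !braketE mulmxDr mxE. Qed.

Lemma braketZl p (z : C) (u v : 'cV[C]_p) : braket (z *: u) v = cconj z * braket u v.
Proof. by rewrite !braketE adjZ -scalemxAl mxE. Qed.

Lemma braketZr p (z : C) (u v : 'cV[C]_p) : braket u (z *: v) = z * braket u v.
Proof. by rewrite !braketE -scalemxAr mxE. Qed.

Definition line_proj p (u : 'cV[C]_p) : 'M[C]_p := (sqnorm u)^-1%:C *: (u *m adj u).
Definition refl p (u : 'cV[C]_p) : 'M[C]_p := 1%:M - (line_proj u + line_proj u).

Lemma line_projP p (u : 'cV[C]_p) : sqnorm u != 0 -> projector (line_proj u).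
Proof. by move=> u0; apply: line_projector. Qed.

Lemma line_projE p (u v : 'cV[C]_p) :
  line_proj u *m v = ((sqnorm u)^-1%:C * braket u v) *: u.
Proof. by rewrite -scalemxAl -mulmxA adj_mulE mul_mx_scalar scalerA. Qed.

Lemma reflE p (u v : 'cV[C]_p) :
  refl u *m v = v - (2 * (sqnorm u)^-1%:C * braket u v) *: u.
Proof.
by rewrite mulmxBl mul1mx mulmxDl line_projE -scalerDl -mulr2n -[in LHS]mulr_natl mulrA.
Qed.

(** Two reflections whose axes enclose the angle phi / 2 compose to the rotation by phi. *)
Definition rotation p (s o : 'cV[C]_p) (tau : R) : 'M[C]_p :=
  refl (s + tau%:C *: o) *m refl s.

Lemma refl_ortho p (u v : 'cV[C]_p) : braket u v = 0 -> refl u *m v = v.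
Proof. by move=> uv; rewrite reflE uv mulr0 scale0r subr0. Qed.

Lemma refl_self p (u : 'cV[C]_p) : sqnorm u != 0 -> refl u *m u = - u.
Proof.
move=> u0; rewrite reflE braket_sqnorm -mulrA -rmorphM /= mulVf //.
by rewrite rmorph1 mulr1 scaler_nat mulr2n opprD addNKr.
Qed.

Section Plane.
Variables (p : nat) (s o : 'cV[C]_p) (tau : R).
Hypotheses (s1 : sqnorm s = 1) (o1 : sqnorm o = 1) (so : braket s o = 0).

Let os : braket o s = 0.
Proof. by rewrite -braket_conj so /cconj conjc0. Qed.

Let sqnorm_axis : sqnorm (s + tau%:C *: o) = 1 + tau ^+ 2.
Proof.
apply: (@complexI R); rewrite -braket_sqnorm !(braketDl, braketDr, braketZl, braketZr).
by rewrite so os !braket_sqnorm s1 o1 /cconj conjc_real; ring.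
Qed.

Lemma rotation_unitary : unitary (rotation s o tau).
Proof.
apply: unitaryM; apply: unitary_reflection; apply: line_projP.
  by rewrite sqnorm_axis sqr1p_neq0.
by rewrite s1 oner_neq0.
Qed.

Lemma rotation_s : rotation s o tau *m s = (rotc tau)%:C *: s + (rots tau)%:C *: o.
Proof.
have s_s : refl s *m s = - s by apply: refl_self; rewrite s1 oner_neq0.
rewrite -mulmxA [X in _ *m X]s_s mulmxN reflE sqnorm_axis.
rewrite braketDl braketZl os braket_sqnorm s1 mulr0 addr0.
have -> : rotc tau = 2 * (1 + tau ^+ 2)^-1 - 1.
  by rewrite /rotc; field; exact: sqr1p_neq0.
have -> : rots tau = 2 * (1 + tau ^+ 2)^-1 * tau by rewrite /rots; ring.
by apply/matrixP=> i j; rewrite !mxE !real_complex_pushE; ring.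
Qed.

Lemma rotation_o : rotation s o tau *m o = (rotc tau)%:C *: o - (rots tau)%:C *: s.
Proof.
rewrite -mulmxA [X in _ *m X](refl_ortho so) reflE sqnorm_axis.
rewrite braketDl braketZl so braket_sqnorm o1 add0r /cconj conjc_real.
have -> : rotc tau = 1 - 2 * (1 + tau ^+ 2)^-1 * tau ^+ 2.
  by rewrite /rotc; field; exact: sqr1p_neq0.
have -> : rots tau = 2 * (1 + tau ^+ 2)^-1 * tau by rewrite /rots; ring.
by apply/matrixP=> i j; rewrite !mxE !real_complex_pushE; ring.
Qed.

Lemma rotation_fix u : braket s u = 0 -> braket o u = 0 -> rotation s o tau *m u = u.
Proof.
move=> su ou; rewrite -mulmxA [X in _ *m X](refl_ortho su) refl_ortho //.
by rewrite braketDl braketZl su ou mulr0 addr0.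
Qed.

Variables (G : 'M[C]_p) (h : 'cV[C]_p).
Hypotheses (GG : unitary G) (Gs : G *m s = s) (sh : braket s h = 0) (oh : braket o h = 0).

(** One walk step: [G] abstracts Q_x L, and [h] the query part of psi_x or of t_y. *)
Let V := G *m rotation s o tau.

Let VV : unitary V.
Proof. exact: unitaryM GG rotation_unitary. Qed.

Let Vs : V *m s = (rotc tau)%:C *: s + (rots tau)%:C *: (G *m o).
Proof. by rewrite -mulmxA rotation_s mulmxDr -!scalemxAr Gs. Qed.

Let Vo : V *m o = (rotc tau)%:C *: (G *m o) - (rots tau)%:C *: s.
Proof. by rewrite -mulmxA rotation_o mulmxBr -!scalemxAr Gs. Qed.

Let Vh : V *m h = G *m h.
Proof. by rewrite -mulmxA rotation_fix. Qed.

(* The hypothesis on [G] makes [w := s + tau (h - o)] an exact fixed vector of [V],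
   at distance [tau |o + h|] from [s]. *)
Lemma walk_stays k : G *m (o + h) = h - o ->
  sqnorm (iter k (mulmx V) s - s) <= 4 * (tau ^+ 2 * sqnorm (o + h)).
Proof.
move=> Gh; pose w := s + tau%:C *: (h - o).
have Gh' : G *m h = h - o - G *m o by rewrite -Gh mulmxDr addrC addKr.
have Vw : V *m w = w.
  rewrite /w mulmxDr -scalemxAr mulmxBr Vs Vo Vh Gh'.
  move: (rotcs tau) (rotsc tau) (G *m o); move: (rotc tau) (rots tau) => c d.
  move=> /(congr1 (real_complex R)) + /(congr1 (real_complex R)) + g.
  rewrite !real_complex_pushE => e1 e2.
  apply/eqP; rewrite -subr_eq0; apply/eqP.
  transitivity ((c%:C + tau%:C * d%:C - 1) *: s +
    (d%:C - tau%:C * c%:C - tau%:C) *: g).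
    by apply/matrixP=> i j; rewrite !mxE; ring.
  by rewrite e1 e2 !subrr !scale0r addr0.
have wk : iter k (mulmx V) s - s = (iter k (mulmx V) s - w) + (w - s).
  by rewrite addrA subrK.
have dk : sqnorm (iter k (mulmx V) s - w) = sqnorm (w - s).
  elim: k {wk} => [|k IH] /=; first by rewrite -sqnormN opprB.
  by rewrite -[X in _ - X]Vw -mulmxBr sqnorm_unitary.
have ws : sqnorm (w - s) = tau ^+ 2 * sqnorm (o + h).
  by rewrite /w addrC addKr sqnormZ -Gh sqnorm_unitary.
have := sqnormD_le (iter k (mulmx V) s - w) (w - s) ltr01.
rewrite -wk dk ws invr1; lra.
Qed.

(** The walk is compared with an ideal rotation in the plane of [s] and [o + h]. Each step errs by a
    vector of norm at most 4 tau |h|, and these errors add up linearly in norm, hence the factor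
    [k%:R ^+ 2]. *)
Lemma walk_moves k : G *m (o + h) = o + h -> tau <= 1 -> 0 <= tau ->
  let z := (rotc tau +i* rots tau) ^+ k in
  sqnorm (iter k (mulmx V) s - ((complex.Re z)%:C *: s + (complex.Im z)%:C *: (o + h)))
    <= k%:R ^+ 2 * (16 * tau ^+ 2 * sqnorm h).
Proof.
move=> Gh tau1 tau0.
have Go : G *m o = o + h - G *m h by rewrite -Gh mulmxDr addrK.
have norm_z k' : let z := (rotc tau +i* rots tau) ^+ k' in
    complex.Re z ^+ 2 + complex.Im z ^+ 2 = 1.
  elim: k' => [|k' IH] /=; first by rewrite expr1n expr0n addr0.
  have cs1 : rotc tau ^+ 2 + rots tau ^+ 2 = 1.
    by rewrite /rotc /rots; field; exact: sqr1p_neq0.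
  move: IH; rewrite (exprSr _ k') /=; case: (_ ^+ k') => a b /= ab.
  have -> : (a * rotc tau - b * rots tau) ^+ 2 + (a * rots tau + b * rotc tau) ^+ 2 =
    (a ^+ 2 + b ^+ 2) * (rotc tau ^+ 2 + rots tau ^+ 2) by ring.
  by rewrite ab cs1 mulr1.
elim: k => [|k IH] /=.
  rewrite ?expr0 /= scale1r scale0r addr0 subrr /sqnorm big1 ?mulr_ge0 ?sqr_ge0 ?sqnorm_ge0 //.
  by move=> i _; rewrite !mxE /= expr0n addr0.
move: (norm_z k) (norm_z k.+1) IH; rewrite (exprSr (_ +i* _) k) /=.
case: (_ ^+ k) => a b /= nab _ IH.
set D := 16 * tau ^+ 2 * sqnorm h in IH *.
set x := iter k (mulmx V) s in IH *.
set e := x - _ in IH.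
pose r := (1 - rotc tau) * b - rots tau * a.
(* [V] maps the ideal state at step [k] to the one at step [k.+1] up to [r%:C *: (G *m h)]. *)
have -> : V *m x - ((a * rotc tau - b * rots tau)%:C *: s +
    (a * rots tau + b * rotc tau)%:C *: (o + h)) = V *m e + r%:C *: (G *m h).
  rewrite /e mulmxBr mulmxDr -!scalemxAr mulmxDr Vs Vo Vh Go /r.
  move: (V *m x) (G *m h) (rotc tau) (rots tau) => y g c d; rewrite !real_complex_pushE.
  by apply/matrixP=> i j; rewrite !mxE; ring.
have rD : sqnorm (r%:C *: (G *m h)) <= D.
  rewrite sqnormZ sqnorm_unitary // /D ler_wpM2r ?sqnorm_ge0 //.
  have d0 : 0 <= rots tau <= 2 * tau.
    rewrite /rots divr_ge0 ?addr_ge0 ?mulr_ge0 ?sqr_ge0 //=.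
    rewrite ler_pdivrMr ?ltr_pwDl ?sqr_ge0 // ler_peMr ?mulr_ge0 //.
    by rewrite lerDl sqr_ge0.
  have c0 : 1 - rotc tau = tau * rots tau by rewrite -(rotcs tau); ring.
  have -> : r = rots tau * (tau * b - a) by rewrite /r c0; ring.
  (* Lagrange's identity with a^2 + b^2 = 1 bounds it by 1 + tau^2. *)
  rewrite exprMn; have : (tau * b - a) ^+ 2 <= 4.
    have : 0 <= (tau * a + b) ^+ 2 by apply: sqr_ge0.
    have -> : (tau * a + b) ^+ 2 = (1 + tau ^+ 2) * (a ^+ 2 + b ^+ 2) - (tau * b - a) ^+ 2.
      by ring.
    by rewrite nab mulr1; nra.
  have : rots tau ^+ 2 <= 4 * tau ^+ 2 by nra.
  move=> h1 h2; have -> : 16 * tau ^+ 2 = 4 * tau ^+ 2 * 4 by ring.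
  by rewrite ler_pM ?sqr_ge0.
case: (posnP k) => [k0|k0].
  move: IH; rewrite k0 expr0n mul0r => /sqnorm_le0 ->.
  by rewrite mulmx0 add0r expr1n mul1r.
have k0' : 0 < k%:R :> R by rewrite ltr0n.
(* Weight 1/k: the bound k^2 D becomes exactly (k + 1)^2 D. *)
rewrite (le_trans (sqnormD_le _ _ (d := k%:R^-1) _)) ?invr_gt0 // sqnorm_unitary // invrK.
have D0 : 0 <= D by rewrite !mulr_ge0 ?sqr_ge0 ?sqnorm_ge0.
have -> : k.+1%:R ^+ 2 * D = (1 + k%:R^-1) * (k%:R ^+ 2 * D) + (1 + k%:R) * D.
  by rewrite -natr1; field; rewrite gt_eqF.
by rewrite lerD // ler_wpM2l // addr_ge0 ?ler01 ?invr_ge0 ?(ltW k0').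
Qed.
End Plane.
End Rotation.

(** * Registers: vectors indexed by basis labels, oracles and diagonal phases *)

Section Registers.
Variable R : realType.
Local Notation C := R[i].
Variables n W : nat.
Local Notation Q := ('I_n * bool * 'I_W)%type.

Lemma mulmx_ext p q (A B : 'M[C]_(p, q)) :
  (forall u : 'cV[C]_q, A *m u = B *m u) -> A = B.
Proof.
move=> AB; apply/matrixP=> i j; have := congr1 (fun M : 'cV_p => M i 0) (AB (delta_mx j 0)).
by rewrite -!colE !mxE.
Qed.

Definition vec (g : Q -> C) : 'cV[C]_(qdim n W) := \col_a g (enum_val a).

Lemma vec_surj (u : 'cV[C]_(qdim n W)) : u = vec (fun q => u (enum_rank q) 0).
Proof. by apply/matrixP=> a j; rewrite ord1 !mxE enum_valK. Qed.

Lemma eq_vec (g h : Q -> C) : g =1 h -> vec g = vec h.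
Proof. by move=> gh; apply/matrixP=> a j; rewrite !mxE gh. Qed.

Lemma braket_vec (g h : Q -> C) : braket (vec g) (vec h) = \sum_q cconj (g q) * h q.
Proof.
by rewrite big_enum_val; apply: eq_bigr => a _; rewrite !mxE.
Qed.

Lemma sum_register (g : Q -> C) : \sum_q g q = \sum_i \sum_b \sum_r g (i, b, r).
Proof. by rewrite pair_bigA pair_bigA; apply: eq_bigr => -[[i b] r] _. Qed.

Lemma flipqK (x : bits n) : involutive (@flipq n W x).
Proof. by case=> [[i b] w] /=; rewrite -addbA addbb addbF. Qed.

Lemma oracle_vec (x : bits n) (g : Q -> C) : oracle R W x *m vec g = vec (g \o flipq x).
Proof.
apply/matrixP=> a j; rewrite !mxE.
rewrite (bigD1 (enum_rank (flipq x (enum_val a)))) //= !mxE enum_rankK flipqK eqxx mul1r.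
rewrite big1 ?addr0 // => c cn; rewrite !mxE; case: eqP => [e|_]; last by rewrite mul0r.
by case/eqP: cn; rewrite e flipqK enum_valK.
Qed.

Lemma oracle_unitary (x : bits n) : unitary (oracle R W x).
Proof.
have OO : oracle R W x *m oracle R W x = 1%:M.
  apply: mulmx_ext => u; rewrite [u]vec_surj -mulmxA !oracle_vec mul1mx.
  by apply: eq_vec => q /=; rewrite flipqK.
rewrite /unitary; suff -> : adj (oracle R W x) = oracle R W x by [].
apply/matrixP=> a c; rewrite !mxE /cconj rmorph_nat; congr (nat_of_bool _)%:R.
by apply/eqP/eqP=> ->; rewrite flipqK.
Qed.

Definition phase (z : Q -> C) : 'M[C]_(qdim n W) := diag_mx (vec z)^T.

Lemma phase_vec (z g : Q -> C) : phase z *m vec g = vec (fun q => z q * g q).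
Proof. by apply/matrixP=> a j; rewrite mul_diag_mx !mxE. Qed.

Lemma phase_unitary (z : Q -> C) : (forall q, z q * cconj (z q) = 1) -> unitary (phase z).
Proof.
move=> zz; apply: mulmx_ext => u; rewrite -mulmxA mul1mx [u]vec_surj.
have -> : adj (phase z) = phase (fun q => cconj (z q)).
  apply/matrixP=> a c; rewrite !mxE [c == a]eq_sym; case: eqP => [->|_] //.
  by rewrite !mulr0n /cconj conjc0.
by rewrite !phase_vec; apply: eq_vec => q; rewrite mulrA zz mul1r.
Qed.

(** Phase kickback: the second query uncomputes the answer written by the first, which leaves a
    diagonal operator. *)
Lemma phase_query_vec (x : bits n) (z g : Q -> C) :
  oracle R W x *m phase z *m oracle R W x *m vec g = vec (fun q => z (flipq x q) * g q).
Proof.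
rewrite -!mulmxA oracle_vec phase_vec oracle_vec.
by apply: eq_vec => q /=; rewrite flipqK.
Qed.

Definition ket (q : Q) : 'cV[C]_(qdim n W) := vec (fun q' => (q' == q)%:R).

Lemma ketE q : ket q = delta_mx (enum_rank q) 0.
Proof.
apply/matrixP=> a j; rewrite !mxE ord1 eqxx andbT; congr (nat_of_bool _)%:R.
by apply/eqP/eqP=> [<-|->]; rewrite ?enum_valK ?enum_rankK.
Qed.

Lemma braket_ket q g : braket (ket q) (vec g) = g q.
Proof.
rewrite braket_vec (bigD1 q) //= eqxx /cconj conjc1 mul1r big1 ?addr0 // => q' /negPf ->.
by rewrite conjc0 mul0r.
Qed.

Lemma sqnorm_ket q : sqnorm (ket q) = 1.
Proof. by apply: (@complexI R); rewrite -braket_sqnorm braket_ket eqxx. Qed.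

End Registers.

(** * Vector families as states, and the two-query reflection *)

Section Embedding.
Variable R : realType.
Local Notation C := R[i].
Variables n k : nat.
Local Notation Q := ('I_n * bool * 'I_k.+1)%type.
Implicit Types (x y : bits n) (w : 'I_n -> 'cV[C]_k).

(* The workspace state [ord0] is left free for the two states |s>, |o> of the
   walk on which queries act trivially. *)
Definition emb x w : 'cV[C]_(qdim n k.+1) := vec (fun q : Q =>
  if unlift ord0 q.2 is Some r then
    if q.1.2 == x q.1.1 then w q.1.1 r 0 else 0
  else 0).

Definition walk_sign (q : Q) : C := if q.1.2 && (q.2 != ord0) then -1 else 1.

Definition negb_bits x : bits n := [ffun i => ~~ x i].

Definition phase_query x := oracle R k.+1 x *m phase walk_sign *m oracle R k.+1 x.

Lemma walk_phase_unitary : unitary (phase walk_sign).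
Proof.
apply: phase_unitary => q; rewrite /walk_sign /cconj.
by case: ifP => _; rewrite ?(rmorphN (@conjc R)) (rmorph1 (@conjc R)) ?mulrNN mulr1.
Qed.

Lemma phase_query_unitary x : unitary (phase_query x).
Proof.
by do 2?apply: unitaryM; try exact: oracle_unitary; exact: walk_phase_unitary.
Qed.

Lemma phase_query_ket x i b : phase_query x *m ket R (i, b, ord0) = ket R (i, b, ord0).
Proof.
rewrite /phase_query phase_query_vec; apply: eq_vec => -[[i' b'] r] /=.
rewrite /walk_sign /=; case: ((i', b', r) =P _) => [[_ _ ->]|_]; last by rewrite mulr0.
by rewrite eqxx andbF mul1r.
Qed.

Lemma phase_query_emb x w : phase_query x *m emb x w = emb x w.
Proof.
rewrite /phase_query phase_query_vec; apply: eq_vec => -[[i b] r] /=.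
rewrite /walk_sign /=; case: unliftP => [r' ->|->]; last by rewrite mulr0.
by case: (b =P x i) => [->|_]; rewrite ?mulr0 // addbb mul1r.
Qed.

Lemma phase_query_emb_negb x w :
  phase_query x *m emb (negb_bits x) w = - emb (negb_bits x) w.
Proof.
have -> : - emb (negb_bits x) w = emb (negb_bits x) (fun i => - w i).
  apply/matrixP=> a j; rewrite !mxE; case: unlift => [r|]; rewrite ?oppr0 //.
  by case: ifP; rewrite ?oppr0 // !mxE.
rewrite /phase_query phase_query_vec; apply: eq_vec => -[[i b] r] /=.
rewrite /walk_sign /=; case: unliftP => [r' ->|->]; last by rewrite mulr0.
by rewrite !mxE ffunE; case: (b =P ~~ x i) => [->|_]; rewrite ?mulr0 // addNb addbb mulN1r.
Qed.

Lemma braket_ket_emb i b x w : braket (ket R (i, b, ord0)) (emb x w) = 0.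
Proof. by rewrite braket_ket /= unlift_none. Qed.

(** The supports meet only where the two bit strings agree. With [negb_bits] on one side this is
    where they differ, which yields the sum in [deciding]. *)
Lemma braket_emb x y w w' : braket (emb x w) (emb y w') =
  \sum_(j < n | x j == y j) braket (w j) (w' j).
Proof.
rewrite braket_vec sum_register /= [RHS]big_mkcond /=.
apply: eq_bigr => j _; rewrite (bigD1 (x j)) //= [X in _ + X]big1 => [|b bx].
  rewrite addr0 big_ord_recl unlift_none /cconj conjc0 mul0r add0r.
  case: (x j =P y j) => _.
    by apply: eq_bigr => r _; rewrite liftK eqxx.
  by rewrite big1 // => r _; rewrite liftK mulr0.
by rewrite big1 // => r _; case: unlift => [r'|]; rewrite ?(negPf bx) /cconj conjc0 mul0r.
Qed.

Lemma sqnorm_emb x w : sqnorm (emb x w) = \sum_(j < n) sqnorm (w j).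
Proof.
apply: (@complexI R); rewrite -braket_sqnorm braket_emb rmorph_sum.
by apply: eq_big => [j|j _]; rewrite ?eqxx ?braket_sqnorm.
Qed.

End Embedding.

(** * The walk as a query algorithm, with its error analysis *)

Section Algorithm.
Variable R : realType.
Local Notation C := R[i].
Local Open Scope complex_scope.

(** A walk step spends two queries, with [M] before the first and [Z] between them. The unitary
    after the last query is the identity; for positive [N] it is distinct from the one at time 0,
    which is [M]. *)
Definition schedule S (Z M : 'M[C]_S) (N t : nat) : 'M[C]_S :=
  if odd t then Z else if t == N.*2 then 1%:M else M.

Lemma run_schedule S (O Z M : 'M[C]_S) (s : 'cV[C]_S) N : (0 < N)%N ->
  run O (schedule Z M N) s N.*2 = iter N (mulmx (O *m Z *m O *m M)) s.
Proof.
case: N => // N _; set N' := N.+1.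
have odd_step j : (j <= N)%N ->
    O *m run O (schedule Z M N') s j.*2.+1 = iter j.+1 (mulmx (O *m Z *m O *m M)) s.
  elim: j => [|j IH] jN.
    by rewrite /= /schedule /= !mulmxA.
  have even_step : run O (schedule Z M N') s j.*2.+2 =
      M *m iter j.+1 (mulmx (O *m Z *m O *m M)) s.
    rewrite -IH ?(ltnW jN) //= {1}/schedule /= odd_double /=.
    by rewrite -doubleS (inj_eq double_inj) ltn_eqF.
  have -> : iter j.+2 (mulmx (O *m Z *m O *m M)) s =
      O *m Z *m O *m (M *m iter j.+1 (mulmx (O *m Z *m O *m M)) s).
    by rewrite iterS !mulmxA.
  rewrite doubleS -even_step /= {1}/schedule /= odd_double /=.
  by rewrite !mulmxA.
rewrite -(odd_step N) // doubleS /= {1}/schedule /= odd_double /= -doubleS eqxx.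
by rewrite mul1mx.
Qed.

(** Accepting projector: outcome 1 means that the walk has left the start state. *)
Definition not_at S (i0 : 'I_S) : 'M[C]_S := 1%:M - delta_mx i0 i0.

Lemma not_at_projector S (i0 : 'I_S) : projector (not_at i0).
Proof.
have dd : delta_mx i0 i0 *m delta_mx i0 i0 = delta_mx i0 i0 :> 'M[C]_S.
  by rewrite mul_delta_mx.
split.
  rewrite /not_at mulmxBl mul1mx mulmxBr mulmx1 dd.
  by rewrite subrr subr0.
rewrite /not_at adjB adj1; congr (_ - _).
apply/matrixP=> a b; rewrite !mxE andbC; case: (_ && _).
  exact: conjc1.
exact: conjc0.
Qed.

Lemma sqnorm_not_at S (i0 : 'I_S) (u : 'cV[C]_S) :
  sqnorm (not_at i0 *m u) =
    sqnorm u - (complex.Re (u i0 0) ^+ 2 + complex.Im (u i0 0) ^+ 2).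
Proof.
have E k : (not_at i0 *m u) k 0 = if k == i0 then 0 else u k 0.
  rewrite mulmxBl mul1mx !mxE (bigD1 i0) //= !mxE eqxx andbT big1 => [|j ji].
    by rewrite addr0; case: (k =P i0) => [->|_]; rewrite ?mul1r ?subrr // mul0r subr0.
  by rewrite mxE (negPf ji) andbF mul0r.
rewrite /sqnorm (bigD1 i0) //= E eqxx [in RHS](bigD1 i0) //= expr0n addr0 add0r.
rewrite addrAC subrr add0r; apply: eq_bigr => k /negPf ki.
by rewrite E ki.
Qed.

Lemma sqnorm_at S (i0 : 'I_S) (u : 'cV[C]_S) :
  sqnorm ((1%:M - not_at i0) *m u) = complex.Re (u i0 0) ^+ 2 + complex.Im (u i0 0) ^+ 2.
Proof.
have E k : ((1%:M - not_at i0) *m u) k 0 = if k == i0 then u i0 0 else 0.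
  rewrite /not_at opprB addrCA subrr addr0 !mxE (bigD1 i0) //= !mxE eqxx andbT big1 => [|j ji].
    by rewrite addr0; case: (k =P i0) => _; rewrite ?mul1r // mul0r.
  by rewrite mxE (negPf ji) andbF mul0r.
rewrite /sqnorm (bigD1 i0) //= E eqxx big1 ?addr0 // => k /negPf ki.
by rewrite E ki /= expr0n addr0.
Qed.

Lemma sqnorm_iter_unitary S (V : 'M[C]_S) (s : 'cV[C]_S) k :
  unitary V -> sqnorm (iter k (mulmx V) s) = sqnorm s.
Proof. by move=> VV; elim: k => //= k IH; rewrite sqnorm_unitary. Qed.

Lemma dyadic_between (a : R) : 1 <= a -> exists2 K, a <= 2 ^+ K & 2 ^+ K <= 2 * a.
Proof.
move=> a1; have a0 : 0 <= a by rewrite (le_trans _ a1).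
have ex : exists K, a <= 2 ^+ K.
  exists (Num.bound a); rewrite (le_trans (ltW (archi_boundP a0))) //.
  by rewrite -natrX ler_nat ltnW // ltn_expl.
exists (ex_minn ex); case: ex_minnP => [[|K]] // aK min.
  by rewrite expr0; lra.
rewrite exprS ler_pM2l // leNgt; apply/negP => /ltW /min.
by rewrite ltnn.
Qed.

Lemma one_sided_algorithm n k (X : {set bits n}) (f : bits n -> bool)
    (v : bits n -> 'I_n -> 'cV[C]_k) (A : R) (i : 'I_n) :
  1 <= A -> (forall x, x \in X -> \sum_j sqnorm (v x j) <= A) ->
  (forall x y, x \in X -> y \in X -> f x -> ~~ f y ->
     \sum_(j | x j != y j) braket (v y j) (v x j) = 1) ->
  exists (T : nat) U i0 P, @computes R n k.+1 T U i0 P X f /\ T%:R <= 512 * A.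
Proof.
move=> A1 vA dec.
(* The number of steps is a power of two because the rotation angle is obtained
   by halving pi / 2. *)
have [K AK KA] : exists2 K, 128 * A <= 2 ^+ K & 2 ^+ K <= 2 * (128 * A).
  by apply: dyadic_between; lra.
have [tau /andP [tau0 tauK] tauI] := root_of_i R K.
(* [alpha * beta = 1] makes psi_x and t_y orthogonal. The factor 8 gives |pos x|^2 <= 1/64 and |o +
   neg x|^2 <= 65 A^2, which suffices for both error bounds below. *)
pose alpha := (8 * Num.sqrt A)^-1; pose beta := 8 * Num.sqrt A.
have sA : 0 < Num.sqrt A by rewrite sqrtr_gt0; lra.
have sA2 : Num.sqrt A ^+ 2 = A by rewrite sqr_sqrtr; lra.
have ba : beta * alpha = 1 by rewrite /alpha /beta divff // mulf_neq0 // gt_eqF.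
have beta2 : beta ^+ 2 = 64 * A by rewrite /beta exprMn sA2; ring.
have alpha2 : alpha ^+ 2 * (64 * A) = 1 by rewrite -beta2 -exprMn mulrC ba expr1n.
pose s := ket R (i, false, ord0 : 'I_k.+1).
pose o := ket R (i, true, ord0 : 'I_k.+1).
pose pos x := emb x (fun j => alpha%:C *: v x j).
pose neg x := emb (negb_bits x) (fun j => (- beta)%:C *: v x j).
have so : braket s o = 0 by rewrite braket_ket !xpair_eqE andbF.
have [P [PP Pneg Portho]] := ortho_projector [pred y in X | ~~ f y] (fun y => o + neg y).
(* [P] projects onto span {t_y}, so [L] negates each t_y and fixes what is orthogonal to all of
   them. *)
pose L := 1%:M - (P + P).
have Ls : L *m s = s.
  rewrite mulmxBl mul1mx mulmxDl Portho ?addr0 ?subr0 // => y _.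
  by rewrite braketDl -braket_conj so -(braket_conj s) braket_ket_emb /cconj conjc0 addr0.
pose M := L *m rotation s o tau; pose T := (2 ^ K).*2.
pose i0 : 'I_(qdim n k.+1) := enum_rank (i, false, ord0 : 'I_k.+1).
exists T, (schedule (phase (@walk_sign R n k)) M (2 ^ K)), i0, (not_at i0).
have LL : unitary L by apply: unitary_reflection.
have RR : unitary (rotation s o tau) by apply: rotation_unitary; rewrite ?sqnorm_ket.
split; last first.
  by rewrite /T -muln2 natrM natrX; lra.
split; [|split; first exact: not_at_projector].
  move=> t _; rewrite /schedule; case: ifP => _.
    exact: walk_phase_unitary.
  by case: ifP => _; [exact: unitary1 | exact: unitaryM].
move=> x Xx; rewrite -ketE /T run_schedule ?expn_gt0 //.
set O := oracle R k.+1 x.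
pose G := phase_query R k x *m L.
have -> : O *m phase (@walk_sign R n k) *m O *m M = G *m rotation s o tau.
  by rewrite /G /M !mulmxA.
have GG : unitary G by apply: unitaryM; [exact: phase_query_unitary | exact: LL].
have Gs : G *m s = s by rewrite -mulmxA Ls phase_query_ket.
set psi := iter _ _ _.
have sqpsi : sqnorm psi = 1.
  exact: etrans (sqnorm_iter_unitary _ _ (unitaryM GG RR)) (sqnorm_ket _ _).
have Lfix u : (forall y, y \in [pred y in X | ~~ f y] -> braket (o + neg y) u = 0) -> L *m u = u.
  by move=> /Portho Pu; rewrite mulmxBl mul1mx mulmxDl Pu addr0 subr0.
have sqZ (z : R) : \sum_j sqnorm (z%:C *: v x j) <= z ^+ 2 * A.
  rewrite (eq_bigr (fun j => z ^+ 2 * sqnorm (v x j))) => [|j _]; last exact: sqnormZ.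
  by rewrite -mulr_sumr ler_wpM2l ?sqr_ge0 // vA.
have tauN : tau * 2 ^+ K <= 1.
  by rewrite -ler_pdivlMr ?exprn_gt0 // div1r.
set N := 2 ^+ K in tauK tauN AK KA.
have N1 : 1 <= N by lra.
have coordE (u : 'cV[C]_(qdim n k.+1)) :
    u i0 0 = braket s u.
  by rewrite [u]vec_surj braket_ket mxE enum_rankK.
case: ifP => fx.
- rewrite sqnorm_not_at sqpsi.
  (* <t_y, psi_x> = 1 - beta alpha = 0, so [L] fixes psi_x, and so does the phase query. *)
  have Gpos : G *m (o + pos x) = o + pos x.
    rewrite -mulmxA Lfix ?mulmxDr ?phase_query_ket ?phase_query_emb // => y /andP [Xy fy].
    rewrite braketDl !braketDr braket_sqnorm sqnorm_ket braket_ket_emb.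
    rewrite -(braket_conj o) braket_ket_emb /cconj conjc0 addr0 add0r braket_emb.
    rewrite (eq_big (fun j => x j != y j)
      (fun j => - (beta * alpha)%:C * braket (v y j) (v x j))) => [|j|j _].
    + by rewrite -mulr_sumr dec // ba mulr1 subrr.
    + by rewrite ffunE; case: (x j); case: (y j).
    + rewrite braketZl braketZr /cconj conjc_real; move: (beta) (alpha) => b a.
      by rewrite !real_complex_pushE (rmorphN (real_complex R)) !mulNr mulrA.
  have tau1 : tau <= 1 by rewrite (le_trans tauK) // invf_le1; lra.
  have := walk_moves (sqnorm_ket R _) (sqnorm_ket R _) so GG Gs (braket_ket_emb _ _ _ _)
    (braket_ket_emb _ _ _ _) (2 ^ K)%N Gpos tau1 tau0.
  rewrite tauI /= scale0r scale1r add0r natrX -/psi -/N => le_err.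
  have sqpos : sqnorm (pos x) <= alpha ^+ 2 * A by rewrite sqnorm_emb.
  have tauN2 : N ^+ 2 * tau ^+ 2 <= 1 by rewrite -exprMn mulrC exprn_ile1 // mulr_ge0 //; lra.
  have err4 : sqnorm (psi - (o + pos x)) <= 1 / 4.
    have := sqnorm_ge0 (pos x); have : 0 <= N ^+ 2 * tau ^+ 2 by rewrite mulr_ge0 ?sqr_ge0.
    by nra.
  (* The target [o + pos x] is orthogonal to [s], so the amplitude of [psi] at [s] is pure error;
     success has probability at least 3/4. *)
  have E0 : (psi - (o + pos x)) i0 0 = psi i0 0.
    rewrite mxE [X in _ + X]mxE [(o + pos x) i0 0]coordE.
    by rewrite braketDr so braket_ket_emb addr0 oppr0 addr0.
  by have := le_trans (sqnorm_coord _ i0) err4; rewrite E0; lra.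
- rewrite sqnorm_at.
  (* [L] negates t_x; the phase query then restores the sign of [neg x] but leaves that of [o]. *)
  have Gneg : G *m (o + neg x) = neg x - o.
    rewrite -mulmxA mulmxBl mul1mx mulmxDl Pneg ?inE ?Xx ?fx // opprD addrA subrr add0r.
    by rewrite mulmxN mulmxDr phase_query_ket phase_query_emb_negb opprD opprK addrC.
  have := walk_stays tau (sqnorm_ket R _) (sqnorm_ket R _) so GG Gs (braket_ket_emb _ _ _ _)
    (braket_ket_emb _ _ _ _) (2 ^ K)%N Gneg.
  rewrite -/psi => le_err.
  have sqneg : sqnorm (o + neg x) <= 65 * A ^+ 2.
    have -> : sqnorm (o + neg x) = 1 + sqnorm (neg x).
      apply: (@complexI R); rewrite rmorphD -!braket_sqnorm !(braketDl, braketDr).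
      rewrite braket_sqnorm sqnorm_ket -(braket_conj o) braket_ket_emb.
      by rewrite /cconj conjc0 addr0 add0r braket_sqnorm.
    have : sqnorm (neg x) <= (- beta) ^+ 2 * A by rewrite sqnorm_emb.
    by rewrite sqrrN beta2; nra.
  have tauA : tau * A <= 1 / 128 by nra.
  (* Distance at most 1/6 from [s] leaves amplitude at least 5/6, and 25/36 > 2/3. *)
  have err36 : sqnorm (psi - s) <= 1 / 36.
    have : (tau * A) ^+ 2 <= (1 / 128) ^+ 2 by rewrite lerXn2r ?nnegrE ?mulr_ge0 //; lra.
    have : 0 <= tau ^+ 2 by apply: sqr_ge0.
    by nra.
  have E0 : (psi - s) i0 0 = psi i0 0 - 1.
    by rewrite mxE [X in _ + X]mxE [s i0 0]coordE braket_sqnorm sqnorm_ket.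
  have := le_trans (sqnorm_coord _ i0) err36; rewrite E0.
  case: (psi i0 0) => a b /=; rewrite oppr0 addr0 => ab.
  have a56 : 5 / 6 <= a by have := sqr_ge0 b; nra.
  by have := sqr_ge0 b; nra.
Qed.
End Algorithm.

(** * Compression to dimension [maxrank], and a lower bound on the size *)

Section Compression.
Variable R : realType.
Local Notation C := R[i].

(** [H] takes orthonormal coordinates of the span, padded with zeros to [k] entries. As [adj H *m H]
    is the orthogonal projector, [H] is isometric on the span and a contraction everywhere. *)
Lemma compress_span (I : finType) (A : {pred I}) q k (t : I -> 'cV[C]_q) :
  (\rank (span_of A t) <= k)%N ->
  exists H : 'M[C]_(k, q),
    (forall i, i \in A -> adj H *m (H *m t i) = t i) /\
    (forall u, sqnorm (H *m u) <= sqnorm u).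
Proof.
have [G [GG Gt _]] := ortho_basis (span_of A t).
move: (\rank _) G GG Gt => r G GG Gt rk.
pose H := (pid_mx r : 'M[C]_(k, r)) *m G.
have HH : adj H *m H = adj G *m G.
  rewrite /H adjM mulmxA -(mulmxA (adj G)).
  have -> : adj (pid_mx r : 'M[C]_(k, r)) = pid_mx r.
    by rewrite /adj (map_pid_mx (@conjc R)) tr_pid_mx.
  rewrite mul_pid_mx minnn.
  by rewrite (minn_idPr rk) pid_mx_1 mulmx1.
set P := adj G *m G in HH.
have aP : adj P = P by rewrite adjM adjK.
have PP : P *m P = P by rewrite /P mulmxA -(mulmxA (adj G)) GG mulmx1.
exists H; split=> [i Ai|u]; first by rewrite mulmxA HH /P -mulmxA Gt ?sub_span_of.
clearbody P.
have -> : sqnorm u = sqnorm (H *m u) + sqnorm (u - adj H *m (H *m u)).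
  apply: (@complexI R); rewrite (rmorphD (real_complex R)) /= -!braket_sqnorm !braketE.
  have eP : adj H *m (H *m u) = P *m u by rewrite mulmxA HH.
  have -> : adj (H *m u) *m (H *m u) = adj u *m (P *m u) by rewrite adjM -mulmxA eP.
  rewrite eP adjB adjM aP mulmxBl !mulmxBr -!mulmxA (mulmxA P P) PP subrr subr0.
  have sumE (a b : 'M[C]_1) : a 0 0 = b 0 0 + (a - b) 0 0 by rewrite !mxE addrCA subrr addr0.
  exact: sumE.
by rewrite lerDl sqnorm_ge0.
Qed.

(** One map per index [j], padded to a common dimension. It is enough that one side of a braket lies
    in the span: [adj H *m H] moves onto v_{x,j} and fixes it. *)
Lemma maxrank_compression n m (X : {set bits n}) (f : bits n -> bool)
    (v : bits n -> 'I_n -> 'cV[C]_m) :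
  exists w : bits n -> 'I_n -> 'cV[C]_(maxrank X f v),
    (forall x j, sqnorm (w x j) <= sqnorm (v x j)) /\
    (forall x y j, x \in X -> f x -> braket (w y j) (w x j) = braket (v y j) (v x j)).
Proof.
have /fin_all_exists [H HP] : forall j : 'I_n, exists H : 'M[C]_(maxrank X f v, m),
    (forall x, x \in [pred x in X | f x] -> adj H *m (H *m v x j) = v x j) /\
    (forall u, sqnorm (H *m u) <= sqnorm u).
  by move=> j; apply: compress_span; rewrite /maxrank (bigD1 j) //= leq_max leqnn.
exists (fun x j => H j *m v x j); split=> [x j|x y j Xx fx].
  exact: (HP j).2.
by rewrite !braketE adjM -mulmxA (HP j).1 // inE Xx fx.
Qed.

Lemma Re_braket_le p (u v : 'cV[C]_p) :
  complex.Re (braket u v) <= (sqnorm u + sqnorm v) / 2.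
Proof.
rewrite /braket (big_morph (@complex.Re R) (id1 := 0) (op1 := +%R)) //; last by case=> a b [].
rewrite /sqnorm -big_split /= mulr_suml; apply: ler_sum => k _.
case: (u k 0) => a b; case: (v k 0) => a' b' /=.
have := sqr_ge0 (a - a'); have := sqr_ge0 (b - b'); nra.
Qed.

Lemma le_vsize n m (X : {set bits n}) (v : bits n -> 'I_n -> 'cV[C]_m) x :
  x \in X -> \sum_j sqnorm (v x j) <= vsize X v.
Proof. exact: (le_bigmax_cond _ (fun x => \sum_j sqnorm (v x j))). Qed.

Lemma vsize_ge0 n m (X : {set bits n}) (v : bits n -> 'I_n -> 'cV[C]_m) : 0 <= vsize X v.
Proof. exact: bigmax_ge_id. Qed.

(** Take real parts in the deciding identity: Re <u, v> <= (|u|^2 + |v|^2) / 2 bounds the sum by the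
    mean of two sizes. *)
Lemma deciding_vsize_ge1 n m (X : {set bits n}) (f : bits n -> bool)
    (v : bits n -> 'I_n -> 'cV[C]_m) x y :
  deciding X f v -> x \in X -> y \in X -> f x != f y -> 1 <= vsize X v.
Proof.
move=> dec Xx Xy fxy; have := congr1 (@complex.Re R) (dec x y Xx Xy fxy).
rewrite (big_morph (@complex.Re R) (id1 := 0) (op1 := +%R)) //=; last by case=> a b [].
move=> <-; apply: le_trans (_ : \sum_j (sqnorm (v x j) + sqnorm (v y j)) / 2 <= _).
  rewrite [leRHS](bigID (fun j => x j != y j)) /= ler_wpDr //.
    by apply: sumr_ge0 => j _; rewrite divr_ge0 // addr_ge0 ?sqnorm_ge0.
  by apply: ler_sum => j _; exact: Re_braket_le.
rewrite -mulr_suml big_split /=; have := le_vsize v Xx; have := le_vsize v Xy; lra.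
Qed.

End Compression.

(** * Dimension count and the final assembly *)

Lemma card_qdim n W : qdim n W = (2 * W * n)%N.
Proof. by rewrite /qdim !card_prod card_bool !card_ord; lia. Qed.

(** For positive [n] and [k], 2 (k + 1) n <= 4 k n <= (2 k n)^2. *)
Lemma qdim_le_exp n k c : (0 < n)%N -> (0 < k)%N -> (1 < c)%N ->
  (qdim n k.+1 <= (2 * k * n) ^ c)%N.
Proof.
move=> n0 k0 c1; apply: (@leq_trans ((2 * k * n) ^ 2)).
  by rewrite card_qdim; nia.
by rewrite leq_pexp2l //; nia.
Qed.

(** The qubit bound is in exponential form: taking logarithms, log S <= c log (2 kappa n). The
    constant [c] is chosen before all other data. *)
Theorem theorem14 :
  exists c : nat,
  forall (R : realType) (n m : nat) (X : {set bits n}) (f : bits n -> bool)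
    (v : bits n -> 'I_n -> 'cV[R[i]]_m),
    deciding X f v ->
    (0 < maxrank X f v)%N ->
    exists (W T : nat) (U : nat -> 'M[R[i]]_(qdim n W)) (i0 : 'I_(qdim n W))
           (P : 'M[R[i]]_(qdim n W)),
      computes T U i0 P X f /\
      (T%:R <= c%:R * vsize X v :> R) /\
      (qdim n W <= (2 * maxrank X f v * n) ^ c)%N.
Proof.
(* 512 is the query constant of the walk; as an exponent, anything above 1 works. *)
exists 512%N => R n m X f v dec k0.
have [i ri] : exists i : 'I_n, (0 < \rank (\sum_(x in X | f x) <<(v x i)^T>>)%MS)%N.
  apply/existsP; apply: contraTT k0 => /existsPn r0.
  by rewrite -leqNgt leqn0 /maxrank big1 // => j _; apply/eqP; rewrite -leqn0 leqNgt r0.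
have n0 : (0 < n)%N := leq_ltn_trans (leq0n i) (ltn_ord i).
have [x /andP [Xx fx]] : exists x, (x \in X) && f x.
  apply/existsP; apply: contraTT ri => /existsPn nx.
  by rewrite big_pred0 ?mxrank0 // => x; apply/negbTE/nx.
(* If [f] is 1 on all of X, [deciding] is vacuous and the size may be below 1, so accept with no
   query. *)
have [allf|/forall_inPn [y Xy fy]] := boolP [forall x in X, f x].
  exists (maxrank X f v).+1, 0%N, (fun=> 1%:M), (enum_rank (i, false, ord0)), 1%:M.
  split; [|split; last exact: qdim_le_exp].
    split=> [t _|]; first exact: unitary1.
    split=> [|z Xz]; first by split; rewrite ?mulmx1 ?adj1.
    rewrite (forall_inP allf) // /= !mul1mx -ketE sqnorm_ket; lra.
  by rewrite mulr_ge0 ?vsize_ge0.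
have [w [wv wdec]] := maxrank_compression X f v.
have A1 : 1 <= vsize X v.
  by apply: (deciding_vsize_ge1 dec Xx Xy); rewrite fx (negbTE fy).
have [||T [U [i0 [P [UP TA]]]]] := @one_sided_algorithm R n _ X f w (vsize X v) i A1.
- move=> z Xz; apply: le_trans (le_vsize v Xz); apply: ler_sum => j _; exact: wv.
- move=> z z' Xz Xz' fz fz'; rewrite -[RHS](dec z' z) //; last by rewrite fz (negbTE fz').
  by apply: eq_big => j; rewrite 1?eq_sym // => _; rewrite wdec.
exists (maxrank X f v).+1, T, U, i0, P; split=> //; split=> //.
exact: qdim_le_exp.
Qed.
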